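(* Let $(\Omega,\Pi)$, $p$, $(\tau_z)_{z\in\mathbb{Z}^d}$ be a random environment on $\mathbb{Z}^d$ and $\Gamma\subseteq\mathbb{Z}^d$ a subgroup satisfying the five assumptions listed in the context (no deterministic walks; decaying transition probabilities; ergodicity with respect to $\Gamma$; partial transitivity with respect to $\Gamma$; absolutely continuous steady state $\Pi_*$). Then the environment viewed from the particle with initial state $\Pi_*$ is ergodic, i.e., the law $\mathcal{P}_{\Pi_*}$ on $\Omega^{\mathbb{N}}$ of the stationary Markov chain with kernel $\mathcal{K}$ and initial distribution $\Pi_*$ is ergodic for the shift on $\Omega^{\mathbb{N}}$.
   Context: Random environment. $(\Omega,\Pi)$ is a complete probability space; for $\omega\in\Omega$, $p(\omega)=(p_{xy}(\omega))_{x,y\in\mathbb{Z}^d}$ is a transition (stochastic) matrix on $\mathbb{Z}^d$ depending measurably on $\omega$; $\mathbb{Z}^d$ acts on $\Omega$ by a group $(\tau_z)_{z\in\mathbb{Z}^d}$ of $\Pi$-automorphisms (invertible $\Pi$-preserving maps) with $p_{xy}(\tau_z\omega)=p_{x+z,y+z}(\omega)$. The dependence on $\omega$ is often omitted. $\mathbb{N}=\{0,1,2,\dots\}$. Walk. For $\omega\in\Omega$, $P_\omega$ is the law on $(\mathbb{Z}^d)^{\mathbb{N}}$ of the Markov chain $(X_n)_{n\in\mathbb{N}}$ with $P_\omega(X_0=0)=1$ and $P_\omega(X_{n+1}=y\mid X_n=x)=p_{xy}(\omega)$. The annealed law on $(\mathbb{Z}^d)^{\mathbb{N}}\times\Omega$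 is $\mathbb{P}(E\times B)=\int_B\Pi(d\omega)P_\omega(E)$. Environment viewed from the particle (EVP): the Markov chain on $\Omega$ with transition kernel $\mathcal{K}(\omega',B)=\sum_{y\in\mathbb{Z}^d}p_{0y}(\omega')\,1_B(\tau_y\omega')$; it is realized by $\Omega_n=\tau_{X_n}\omega$. Assumptions: - No deterministic walks: let $\Omega_{\mathrm d}$ be the set of $\omega$ for which there is $y_o\in\mathbb{Z}^d$ with $p_{0y}(\omega)=\delta_{y_oy}$ for all $y\in\mathbb{Z}^d$ ($\delta$ is the Kronecker delta). Then $\mathbb{P}$-almost surely there is $n\in\mathbb{N}$ with $\tau_{X_n}\omega\notin\Omega_{\mathrm d}$. - Decaying transition probabilities: there exist $K,\gamma>0$ such that, $\Pi$-almost surely, $p_{xy}\le K|y-x|^{-d-\gamma}$ for all $x\neq y$. - Ergodicity: $\Gamma$ is a subgroup of $\mathbb{Z}^d$ such that $(\Omega,\Pi,(\tau_z)_{z\in\Gamma})$ is ergodic. - Partial transitivity: with the same $\Gamma$, let $\Omega_{\mathrm t}$ be the set of $\omega$ such that for every $y\in\Gamma$ there is $n=n(\omega,y)\ge1$ with $p^{(n)}_{0y}(\omega)>0$, where $p^{(n)}_{0y}=\sum_{x_1,\dots,x_{n-1}}p_{0x_1}p_{x_1x_2}\cdots p_{x_{n-1}y}$. Then $\Pi(\Omega_{\mathrm t})>0$. - Absolutely continuous steady state: there is a probability measure $\Pi_*$ on $\Omega$, absolutely continuous with respect to $\Pi$, that is stationary for the EVP, i.e., $\int_\Omega\Pi_*(d\omega')\mathcal{K}(\omega',B)=\Pi_*(B)$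 for all measurable $B$, and $\Pi_*(\Omega_{\mathrm t})>0$. *)

(* Defs.v *)
From HB Require Import structures.
From mathcomp Require Import all_boot all_order all_algebra.
From mathcomp Require Import all_classical all_reals all_analysis.

Set Implicit Arguments.
Unset Strict Implicit.
Unset Printing Implicit Defensive.
Import Order.TTheory GRing.Theory Num.Theory.
Import numFieldNormedType.Exports.

Local Open Scope classical_set_scope.
Local Open Scope ring_scope.

(* The lattice Z^d with its discrete sigma-algebra. *)
Definition Zd (d : nat) : Type := 'rV[int]_d.

HB.instance Definition _ (d : nat) := GRing.Zmodule.on (Zd d).
HB.instance Definition _ (d : nat) := isPointed.Build (Zd d) 0.
HB.instance Definition _ (d : nat) := @isMeasurable.Build
  default_measure_display (Zd d) (@discrete_measurable (Zd d))
  (@discrete_measurable0 (Zd d)) (@discrete_measurableC (Zd d))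
  (@discrete_measurableU (Zd d)).

Definition Zd_norm (R : realType) (d : nat) (x : Zd d) : R :=
  Num.sqrt (\sum_(i < d) ((x : 'rV[int]_d) ord0 i)%:~R ^+ 2).

Section SequenceSpace.
Variables (disp : measure_display) (T : measurableType disp).

Definition coordinate_events : set (set (nat -> T)) :=
  [set E | exists n, exists2 B, measurable B & E = [set x | B (x n)]].

(* T^N with the product sigma-algebra. *)
Definition seqspace := g_sigma_algebraType coordinate_events.

Definition seqshift (x : seqspace) : seqspace := fun n => x n.+1.

End SequenceSpace.

Section Ergodicity.
Variables (R : realType) (disp : measure_display) (T : measurableType disp).

Definition measure_preserving (mu : probability T R) (f : T -> T) : Prop :=
  measurable_fun setT f /\
  forall B, measurable B -> mu (f @^-1` B) = mu B.

(* Ergodicity of the measure-preserving system given by a set S of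
   transformations: the events invariant under all of S are trivial. *)
Definition ergodic (mu : probability T R) (S : set (T -> T)) : Prop :=
  (forall f, S f -> measure_preserving mu f) /\
  forall B, measurable B -> (forall f, S f -> f @^-1` B = B) ->
    mu B = 0%E \/ mu B = 1%E.

Local Open Scope ereal_scope.

(* Q is the law of the Markov chain with initial distribution mu and transition
   kernel K.  The second clause is the Markov property
     Q(w_(n+1) \in B | w_0, ..., w_n) = K(w_n, B)
   integrated over the events {w_i \in B_i for all i <= n}, which form a
   pi-system generating the history up to time n. *)
Definition markov_chain_law (mu : probability T R) (K : T -> set T -> \bar R)
    (Q : probability (seqspace T) R) : Prop :=
  (forall B, measurable B -> Q [set w | B (w 0%N)] = mu B) /\
  forall (n : nat) (B : nat -> set T), (forall i, measurable (B i)) ->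
    Q [set w | forall i, (i <= n.+1)%N -> B i (w i)] =
    \int[Q]_(w in [set w | forall i, (i <= n)%N -> B i (w i)])
      K (w n) (B n.+1).

End Ergodicity.

Section Lattice.
Variables (R : realType) (d : nat).

(* The law on (Z^d)^N of the Markov chain started at 0 with transition matrix
   q; conditional probabilities are multiplied out, so that conditioning on
   null events imposes nothing. *)
Definition walk_law (q : Zd d -> Zd d -> R)
    (P : probability (seqspace (Zd d)) R) : Prop :=
  (P [set X | X 0%N = 0%R] = 1 /\
   forall (n : nat) (x : nat -> Zd d),
    P [set X | forall i, (i <= n.+1)%N -> X i = x i] =
    P [set X | forall i, (i <= n)%N -> X i = x i] * (q (x n) (x n.+1))%:E)%E.

(* q x y_1 * q y_1 y_2 * ... * q y_(k-1) y_k for s = [:: y_1; ...; y_k] *)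
Fixpoint path_weight (q : Zd d -> Zd d -> R) (x : Zd d) (s : seq (Zd d)) : R :=
  if s is y :: s' then q x y * path_weight q y s' else 1.

(* The n-step transition probability, for n >= 1: the sum runs over the n - 1
   intermediate points of a path from x to y. *)
Definition nstep (q : Zd d -> Zd d -> R) (n : nat) (x y : Zd d) : \bar R :=
  (\esum_(s in [set: n.-1.-tuple (Zd d)]) (path_weight q x (rcons s y))%:E)%E.

End Lattice.

Section RandomEnvironment.
Variables (R : realType) (disp : measure_display) (Omega : measurableType disp).
Variables (d : nat) (Pi : probability Omega R).
Variables (p : Omega -> Zd d -> Zd d -> R) (tau : Zd d -> Omega -> Omega).
Variable (Gamma : zmodClosed (Zd d)).

Record random_environment : Prop := RandomEnvironment {
  env_complete : measure_is_complete Pi;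
  env_ge0 : forall w x y, 0 <= p w x y;
  env_sum1 : forall w x, (\esum_(y in [set: Zd d]) (p w x y)%:E = 1)%E;
  env_measurable : forall x y, measurable_fun setT (fun w => p w x y);
  env_tau0 : forall w, tau 0 w = w;
  env_tauD : forall z z' w, tau (z + z') w = tau z (tau z' w);
  env_tau_preserving : forall z, measure_preserving Pi (tau z);
  env_shift : forall z w x y, p (tau z w) x y = p w (x + z) (y + z)
}.

Definition annealed_law (Pw : Omega -> probability (seqspace (Zd d)) R)
    (P : probability (seqspace (Zd d) * Omega)%type R) : Prop :=
  forall E B, measurable E -> measurable B ->
    (P (E `*` B) = \int[Pi]_(w in B) Pw w E)%E.

Definition evp_kernel (w : Omega) (B : set Omega) : \bar R :=
  (\esum_(y in [set: Zd d]) ((p w 0 y)%:E * (\1_B (tau y w))%:E))%E.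

Definition Omega_d : set Omega :=
  [set w | exists y0, forall y, p w 0 y = (y0 == y)%:R].

Definition no_deterministic_walks
    (P : probability (seqspace (Zd d) * Omega)%type R) : Prop :=
  {ae P, forall Xw, exists n : nat, ~ Omega_d (tau (Xw.1 n) Xw.2)}.

Definition decaying_transitions : Prop :=
  exists K gamma : R, [/\ 0 < K, 0 < gamma &
    {ae Pi, forall w, forall x y, x != y ->
      p w x y <= K * Zd_norm R (y - x) `^ (- d%:R - gamma)}].

Definition Omega_t : set Omega :=
  [set w | forall y, y \in Gamma ->
    exists2 n : nat, (1 <= n)%N & (0 < nstep (p w) n 0%R y)%E].

Definition partial_transitivity : Prop := (0 < Pi Omega_t)%E.

Definition ergodic_environment : Prop :=
  ergodic Pi (tau @` [set z | z \in Gamma]).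

Definition ac_steady_state (Pis : probability Omega R) : Prop :=
  [/\ Pis `<< Pi,
      forall B, measurable B -> (\int[Pis]_w evp_kernel w B = Pis B)%E &
      (0 < Pis Omega_t)%E].

End RandomEnvironment.

(* Main.v *)
From HB Require Import structures.
Require Import Defs.
From mathcomp Require Import all_boot all_order all_algebra.
From mathcomp Require Import all_classical all_reals all_analysis.
From mathcomp Require Import measurable_realfun lebesgue_measure giry.

Set Implicit Arguments.
Unset Strict Implicit.
Unset Printing Implicit Defensive.
Import Order.TTheory GRing.Theory Num.Theory.

Local Open Scope classical_set_scope.
Local Open Scope ring_scope.

(* A shift-invariant event A of a stationary Markov chain coincides almost
   surely with {w_0 \in B} for some B: if h (w_n) denotes the conditional
   probability of A given w_0, ..., w_n, then h (w_n) tends to the indicator of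
   A, so that by stationarity h (w_0) = 1 almost surely on A, and one takes
   B = {h = 1}.  Moreover the chain almost surely neither leaves nor enters B.
   For the environment viewed from the particle, B or its complement, say B,
   meets Omega_t in a set of positive Pis-measure.  Let S be the set where the
   density dPis/dPi is positive.  Up to a Pi-null set B `&` S is closed under
   the transitions, hence from a point of B `&` S `&` Omega_t all translates by
   Gamma stay in B `&` S.  The event that all Gamma-translates lie in B `&` S
   is Gamma-invariant and has positive Pi-measure, so it has full measure. *)

Local Open Scope ereal_scope.

(** * Null sets, supports of densities and sums of nonnegative terms *)

Lemma ge0_integral_eq0_null {d : measure_display} {T : measurableType d}
    {R : realType} (mu : {measure set T -> \bar R}) (D : set T) (g : T -> \bar R) :
  measurable D -> measurable_fun [set: T] g -> (forall x, 0 <= g x) ->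
  \int[mu]_(x in D) g x = 0 -> mu (D `&` [set x | 0 < g x]) = 0.
Proof.
move=> mD mg g0 intg0.
have mDg : measurable (D `&` [set x | 0 < g x]).
  apply: measurable_lte => //; exact: measurable_funTS.
have : \int[mu]_(x in D) `|g x| = 0 by under eq_integral do rewrite gee0_abs//.
move/(ae_eq_integral_abs _ mD (measurable_funTS mg)) => [N [mN N0 subN]].
apply: (subset_measure0 mDg mN _ N0) => x [Dx /= gx]; apply: subN => /= /(_ Dx).
by move=> gx0; move: gx; rewrite gx0 ltxx.
Qed.

(** [S] is the set where the Radon-Nikodym density is positive: a subset of [S] on which the density
    integrates to 0 must be [mu]-null. This carries null sets back from [nu] to [mu], against the
    direction of absolute continuity. *)
Lemma ac_support {d : measure_display} {T : measurableType d} {R : realType}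
    (nu mu : probability T R) : nu `<< mu ->
  exists S, [/\ measurable S, nu (~` S) = 0 &
    forall N, measurable N -> N `<=` S -> nu N = 0 -> mu N = 0].
Proof.
move=> numu; pose f := Radon_Nikodym_SigmaFinite.f nu mu.
have f0 := Radon_Nikodym_SigmaFinite.f_ge0 numu.
have fint := Radon_Nikodym_SigmaFinite.f_integrable numu.
have fE := Radon_Nikodym_SigmaFinite.f_integral numu.
have mf : measurable_fun [set: T] f := measurable_int _ fint.
have mS : measurable [set x | 0 < f x].
  rewrite -[X in measurable X]setTI; apply: measurable_lte => //.
exists [set x | 0 < f x]; split => //.
  rewrite fE; last exact: measurableC.
  rewrite integral0_eq// => x /= /negP.
  by rewrite -leNgt => fx; apply/eqP; rewrite eq_le fx f0.
move=> N mN NS; rewrite fE// => /(ge0_integral_eq0_null mN mf f0).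
by rewrite setIidl.
Qed.

Lemma esum_gt0P {R : realType} {I : choiceType} (a : I -> \bar R) :
  (forall i, 0 <= a i) ->
  0 < \esum_(i in [set: I]) a i <-> exists i, 0 < a i.
Proof.
move=> a0; split=> [|[i ai]].
  apply: contraPP => /forallNP nai; rewrite esum1 ?ltxx// => i _.
  by apply/eqP; rewrite eq_le a0 andbT leNgt; apply/negP.
apply: (lt_le_trans ai); apply: esum_ge; exists [set i]; last by rewrite fsbig_set1.
by split => //; exact: finite_set1.
Qed.

Lemma ge0_integralID {d : measure_display} {T : measurableType d} {R : realType}
    (mu : {measure set T -> \bar R}) (E D : set T) (g : T -> \bar R) :
  measurable E -> measurable D ->
  measurable_fun [set: T] g -> (forall x, 0 <= g x) ->
  \int[mu]_(x in E) g x =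
  \int[mu]_(x in E `&` D) g x + \int[mu]_(x in E `\` D) g x.
Proof.
move=> mE mD mg g0; rewrite -{1}(setUIDK E D) ge0_integral_setU//.
- exact: measurableI.
- exact: measurableD.
- exact: measurable_funTS.
- by apply/disj_setPS => x /= [[_ ?] [_]].
Qed.

(** * Integration against measurable families of subprobabilities *)

Section GiryIntegral.
Context {d1 d2 : measure_display} {T1 : measurableType d1}
  {T2 : measurableType d2} {R : realType}.

Lemma measurable_giry_comp (k : T1 -> giry T2 R) (g : T2 -> \bar R) :
  measurable_fun [set: _] k -> measurable_fun setT g -> (forall x, 0 <= g x) ->
  measurable_fun [set: _] (fun w => giry_int (k w) g).
Proof.
move=> mk mg g0.
exact: (measurableT_comp (measurable_giry_int mg g0) mk).
Qed.

Lemma measurable_giry_eval (k : T1 -> giry T2 R) (A : set T2) :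
  measurable_fun [set: _] k -> measurable A -> measurable_fun setT (fun w => k w A).
Proof. by move=> mk mA; exact: (measurableT_comp (measurable_giry_ev mA) mk). Qed.

(** Each side is the integral of [g] against one measure, the [mu]-mixture over [E] of the kernel.
    The two mixtures agree on every event, hence as integrators. *)
Lemma integral_kernel_eq (mu : probability T1 R) (E : set T1)
    (k1 k2 : T1 -> giry T2 R) (g : T2 -> \bar R) :
  measurable E -> measurable_fun [set: _] k1 -> measurable_fun setT k2 ->
  (forall A, measurable A ->
    \int[mu]_(w in E) k1 w A = \int[mu]_(w in E) k2 w A) ->
  measurable_fun [set: _] g -> (forall x, 0 <= g x) ->
  \int[mu]_(w in E) giry_int (k1 w) g = \int[mu]_(w in E) giry_int (k2 w) g.
Proof.
move=> mE mk1 mk2 k12 mg g0.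
(* The restriction to [E] is absorbed into the kernel as the zero measure outside [E], which is
   allowed because [giry] consists of subprobabilities. *)
pose r (k : T1 -> giry T2 R) w : giry T2 R := if w \in E then k w else mzero.
have mr k : measurable_fun [set: _] k -> measurable_fun setT (r k).
  move=> mk; apply: measurable_giry_codensity => // B mB.
  have -> : (r k ^~ B) = (fun w => k w B) \_ E.
    by apply/funext => w; rewrite /r /patch; case: ifPn.
  by apply/(measurable_restrictT _ mE); apply: measurable_funTS;
    exact: measurable_giry_eval.
have int_r k (mk : measurable_fun [set: _] k) (mrk : measurable_fun setT (r k)) :
    \int[mu]_(w in E) giry_int (k w) g = giry_int (giry_bind mu mrk) g.
  rewrite giry_int_bind// integral_mkcond; apply: eq_integral => w _.
  rewrite /r /patch; case: ifPn => // _.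
  by rewrite /giry_int integral_measure_zero.
rewrite (int_r _ mk1 (mr _ mk1)) (int_r _ mk2 (mr _ mk2)).
apply: eq_measure_integral => A mA _.
have ev k (mk : measurable_fun [set: _] k) (mrk : measurable_fun setT (r k)) :
    giry_bind mu mrk A = \int[mu]_(w in E) k w A.
  rewrite [LHS]giry_int_map//; last exact: measurable_giry_ev.
  rewrite integral_mkcond; apply: eq_integral => w _.
  by rewrite /r /patch /= /giry_ev; case: ifPn.
exact: etrans (ev _ mk1 _) (etrans (k12 _ mA) (esym (ev _ mk2 _))).
Qed.

End GiryIntegral.

(** * The sequence space: shift, cylinder events and induction on events *)

Section SequenceSpaceTheory.
Context {d : measure_display} {T : measurableType d}.
Local Notation S := (seqspace T).

Lemma measurable_coord (n : nat) : measurable_fun setT (fun w : S => w n).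
Proof.
move=> _ B mB; rewrite setTI.
by apply: sub_sigma_algebra; exists n, B.
Qed.

Lemma measurable_coord_set (n : nat) (B : set T) :
  measurable B -> measurable [set w : S | B (w n)].
Proof. by move=> mB; rewrite -[X in measurable X]setTI; exact: measurable_coord. Qed.

Lemma measurable_seqshift : measurable_fun setT (@seqshift d T).
Proof.
apply: (@measurability _ _ S S setT _ (@coordinate_events d T)) => //.
move=> _ [_ [n [B mB ->]] <-]; rewrite setTI.
exact: (measurable_coord_set n.+1).
Qed.

Lemma measurable_iter_seqshift (n : nat) :
  measurable_fun setT (iter n (@seqshift d T)).
Proof.
elim: n => [|n IH]; first exact: measurable_id.
exact: (measurableT_comp measurable_seqshift IH).
Qed.

Lemma measurable_iter_preimage (n : nat) (C : set S) :
  measurable C -> measurable (iter n (@seqshift d T) @^-1` C).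
Proof.
by move=> mC; rewrite -[X in measurable X]setTI; exact: measurable_iter_seqshift.
Qed.

Lemma iter_seqshiftE (n m : nat) (w : S) : iter n (@seqshift d T) w m = w (n + m)%N.
Proof. by elim: n m => [//|n IH] m; rewrite iterS /seqshift IH addnS. Qed.

(** These are exactly the histories over which [markov_chain_law] integrates the Markov property. *)
Definition box (n : nat) (E : set S) : Prop :=
  exists2 B : nat -> set T, forall i, measurable (B i) &
    E = [set w | forall i, (i <= n)%N -> B i (w i)].

Lemma box_coord (n i : nat) (A : set T) :
  (i <= n)%N -> measurable A -> box n [set w | A (w i)].
Proof.
move=> le_in mA; exists (fun j => if j == i then A else setT) => [j|].
  by case: ifP.
apply/seteqP; split=> w /=; first by move=> Aw j _; case: eqP => [->|].
by move/(_ i le_in); rewrite eqxx.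
Qed.

Lemma boxI (n : nat) (E F : set S) : box n E -> box n F -> box n (E `&` F).
Proof.
move=> [B mB ->] [C mC ->]; exists (fun i => B i `&` C i) => [i|].
  exact: measurableI.
apply/seteqP; split=> w /=; first by move=> [Bw Cw] i le_in; split; auto.
by move=> BCw; split=> i le_in; have [] := BCw i le_in.
Qed.

Lemma boxT (n : nat) : box n setT.
Proof. by exists (fun=> setT) => //; apply/seteqP; split. Qed.

Lemma box_widen (m n : nat) (E : set S) : (m <= n)%N -> box m E -> box n E.
Proof.
move=> le_mn [B mB ->]; exists (fun i => if (i <= m)%N then B i else setT) => [i|].
  by case: ifP.
apply/seteqP; split=> w /=; first by move=> Bw i _; case: ifP => // /Bw.
by move=> Bw i le_im; have := Bw i (leq_trans le_im le_mn); rewrite le_im.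
Qed.

Lemma box_measurable (n : nat) (E : set S) : box n E -> measurable E.
Proof.
move=> [B mB ->].
rewrite [X in measurable X](_ : _ =
    \bigcap_i [set w : S | (i <= n)%N -> B i (w i)]); last first.
  by apply/seteqP; split=> w /= Bw i; [move=> _|]; exact: Bw.
apply: bigcap_measurable => [|i _]; first by exists 0%N.
have [le_in|/negbTE gt_in] := boolP (i <= n)%N.
  rewrite [X in measurable X](_ : _ = [set w : S | B i (w i)]).
    exact: measurable_coord_set.
  by apply/seteqP; split=> w /=; auto.
by rewrite [X in measurable X](_ : _ = setT)//; apply/seteqP; split.
Qed.

(** Splitting off the first coordinate drives the induction on the length of a cylinder in
    [future_density_box]. *)
Lemma boxS_inv (n : nat) (E : set S) : box n.+1 E -> exists A F,
  [/\ measurable A, box n F &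
    E = [set w | A (w 0%N)] `&` @seqshift d T @^-1` F].
Proof.
move=> [B mB ->]; exists (B 0%N).
exists [set w : S | forall i, (i <= n)%N -> B i.+1 (w i)]; split=> //.
  by exists (fun i => B i.+1).
apply/seteqP; split=> w /=.
  by move=> Bw; split=> [|i le_in]; [exact: (Bw 0%N)|exact: (Bw i.+1)].
by move=> [B0 BS] [|i] //= le_in; exact: BS.
Qed.

Lemma box0_inv (E : set S) : box 0 E ->
  exists2 A, measurable A & E = [set w | A (w 0%N)].
Proof.
move=> [B mB ->]; exists (B 0%N) => //.
apply/seteqP; split=> w /= Bw; first exact: Bw.
by move=> i; rewrite leqn0 => /eqP ->.
Qed.

(** Dynkin's theorem: the boxes of all lengths form a pi-system, by widening two of them to a common
    length, and they generate the product sigma-algebra. *)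
Lemma box_induction (P : set S -> Prop) :
  P setT -> (forall n E, box n E -> P E) ->
  (forall E, measurable E -> P E -> P (~` E)) ->
  (forall F : (set S)^nat, (forall n, measurable (F n)) -> trivIset setT F ->
    (forall n, P (F n)) -> P (\bigcup_k F k)) ->
  forall E, measurable E -> P E.
Proof.
move=> PT Pbox PC PU.
pose G := [set E : set S | exists n, box n E].
have GE : @measurable _ S = <<s G >>.
  apply/seteqP; split; last first.
    apply: smallest_sub; first exact: sigma_algebra_measurable.
    by move=> E [n] /box_measurable.
  apply: smallest_sub; first exact: smallest_sigma_algebra.
  move=> _ [n [B mB ->]]; apply: sub_sigma_algebra; exists n.
  exact: box_coord.
have GI : setI_closed G.
  move=> E F [m bE] [n bF]; exists (maxn m n).
  by apply: boxI; [apply: box_widen bE|apply: box_widen bF];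
    rewrite ?leq_maxl ?leq_maxr.
move=> E mE; apply: (@dynkin_induction _ S G P GE GI) => //.
  by move=> F [n]; exact: Pbox.
by rewrite -GE.
Qed.

End SequenceSpaceTheory.

(** * Stationary Markov chains: invariant events depend on the initial state *)

Section StationaryMarkovChain.
Context {d : measure_display} {T : measurableType d} {R : realType}.
Context {mu : probability T R} {K : T -> giry T R} {Q : probability (seqspace T) R}.
Hypothesis mK : measurable_fun setT K.
Hypothesis lawQ : markov_chain_law mu (fun x A => K x A) Q.
Hypothesis stationary : forall A, measurable A -> \int[mu]_x K x A = mu A.
Local Notation S := (seqspace T).
Local Notation shift := (@seqshift d T).

Lemma measurable_fun_coord {d'} {U : measurableType d'} (g : T -> U) n :
  measurable_fun setT g -> measurable_fun setT (fun w : S => g (w n)).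
Proof. by move=> mg; apply: (measurableT_comp mg); exact: measurable_coord. Qed.

Lemma markov_set n (E : set S) (A : set T) : box n E -> measurable A ->
  Q (E `&` [set w | A (w n.+1)]) = \int[Q]_(w in E) K (w n) A.
Proof.
move=> [B mB ->] mA.
(* Only the entry at [n.+1] has to be [A]; later entries do not enter the event. *)
pose C i := if (i <= n)%N then B i else A.
have mC i : measurable (C i) by rewrite /C; case: ifP.
have := lawQ.2 n C mC; rewrite {3}/C ltnn.
have -> : [set w : S | forall i, (i <= n)%N -> C i (w i)] =
          [set w : S | forall i, (i <= n)%N -> B i (w i)].
  by apply/seteqP; split=> w /= Bw i le_in; have := Bw i le_in; rewrite /C le_in.
move=> <-; congr (Q _); apply/seteqP; split=> w /=.
  move=> [Bw Aw] i; rewrite leq_eqVlt => /predU1P[->|].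
    by rewrite /C ltnn.
  by rewrite ltnS /C => le_in; rewrite le_in; exact: Bw.
move=> Cw; split=> [i le_in|].
  by have := Cw i (leqW le_in); rewrite /C le_in.
by have := Cw n.+1 (leqnn _); rewrite /C ltnn.
Qed.

(** The Dirac mass at [w n.+1] and [K (w n)] are two kernels whose mixtures over [E] coincide by
    [markov_set], so [integral_kernel_eq] applies. *)
Lemma markov_integral n (E : set S) (g : T -> \bar R) : box n E ->
  measurable_fun [set: T] g -> (forall x, 0 <= g x) ->
  \int[Q]_(w in E) g (w n.+1) = \int[Q]_(w in E) giry_int (K (w n)) g.
Proof.
move=> bE mg g0; have mE := box_measurable bE.
pose k1 (w : S) : giry T R := giry_ret (w n.+1).
pose k2 (w : S) : giry T R := K (w n).
have mk1 : measurable_fun setT k1.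
  exact: (measurable_fun_coord n.+1 measurable_giry_ret).
have mk2 : measurable_fun setT k2 by exact: measurable_fun_coord.
rewrite -(integral_kernel_eq mE mk1 mk2 _ mg g0).
  by apply: eq_integral => w _; rewrite giry_int_ret.
move=> A mA; rewrite -markov_set// setIC -integral_indic//; last first.
  exact: measurable_coord_set.
Qed.

(* h (w_n) is a version of Q(shift^n w \in C | w_0, ..., w_n), for every n. *)
Definition future_density (C : set S) (h : T -> \bar R) : Prop :=
  [/\ measurable_fun [set: T] h, forall x, 0 <= h x &
    forall n E, box n E ->
      Q (E `&` iter n shift @^-1` C) = \int[Q]_(w in E) h (w n)].

(** Truncation changes nothing where [h] is at most 1. On the box [E] cut by [1 < h (w n)], the
    integral of [h] is the probability of a subevent, so it is at most the integral of 1, which is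
    that of the truncation. *)
Lemma future_density_truncate C h : measurable C -> future_density C h ->
  future_density C (fun x => mine (h x) 1).
Proof.
move=> mC [mh h0 hC].
have mm : measurable_fun [set: T] (fun x => mine (h x) 1).
  by apply: measurable_mine => //; exact: measurable_cst.
have m0 x : 0 <= mine (h x) 1 by rewrite le_min h0 lee01.
split=> // n E bE; rewrite hC//.
pose D := [set x | 1 < h x].
have mD : measurable D.
  by rewrite -[D]setTI; apply: measurable_lte => //; exact: measurable_cst.
have mE := box_measurable bE.
have mDn := measurable_coord_set n mD.
have bED : box n (E `&` [set w | D (w n)]) by apply: boxI => //; exact: box_coord.
have mhn := measurable_fun_coord n mh.
have mmn := measurable_fun_coord n mm.
have mEDn : measurable (E `&` [set w | D (w n)]) by exact: measurableI.
rewrite !(@ge0_integralID _ _ _ Q E [set w | D (w n)])//.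
congr (_ + _).
  apply/eqP; rewrite eq_le; apply/andP; split; last first.
    apply: ge0_le_integral => //.
    - exact: measurable_funTS.
    - exact: measurable_funTS.
    - by move=> w _; rewrite ge_min lexx.
  rewrite -hC//.
  apply: (@le_trans _ _ (Q (E `&` [set w | D (w n)]))).
    apply: le_measure; rewrite ?inE; [|exact: measurableI|exact: subIsetl].
    by apply: measurableI; [exact: measurableI|exact: measurable_iter_preimage].
  rewrite -[X in X <= _]mul1e -integral_cst//.
  rewrite (eq_integral (fun w : S => mine (h (w n)) 1))// => w /[!inE] -[_ /= Dw].
  by rewrite min_r// ltW.
apply: eq_integral => w /[!inE] -[_ /= /negP Dw].
by rewrite min_l// leNgt.
Qed.

Lemma future_densityC C h : measurable C -> future_density C h ->
  future_density (~` C) (fun x => 1 - mine (h x) 1).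
Proof.
move=> mC hC; have [mm m0 mE] := future_density_truncate mC hC.
have m1 x : mine (h x) 1 <= 1 by rewrite ge_min lexx orbT.
have m1B : measurable_fun [set: T] (fun x => 1 - mine (h x) 1).
  by apply: emeasurable_funB => //; exact: measurable_cst.
have mfin x : mine (h x) 1 \is a fin_num.
  by rewrite ge0_fin_numE// (le_lt_trans (m1 x))// ltry.
have m1B0 x : 0 <= 1 - mine (h x) 1 by rewrite sube_ge0 ?m1// mfin orbT.
split=> // n E bE.
have mbE := box_measurable bE.
have mCn := measurable_iter_preimage n mC.
have mECn : measurable (E `&` iter n shift @^-1` C) by exact: measurableI.
(* Finiteness permits adding the probability of the part inside [C] to both sides and cancelling it
   in the extended reals. *)
have fC : Q (E `&` iter n shift @^-1` C) \is a fin_num by rewrite fin_num_measure.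
rewrite -[LHS](addeK _ fC) [X in _ = X](_ : _ =
  \int[Q]_(w in E) (1 - mine (h (w n)) 1) + Q (E `&` iter n shift @^-1` C) -
    Q (E `&` iter n shift @^-1` C)); last by rewrite addeK.
congr (_ - _).
rewrite preimage_setC -setDE -measureDI// {1}mE//.
rewrite -ge0_integralD//; [|exact: measurable_funTS (measurable_fun_coord n m1B)|exact: measurable_funTS (measurable_fun_coord n mm)].
rewrite -[LHS]mul1e -integral_cst//; apply: eq_integral => w _.
by rewrite subeK.
Qed.

Lemma future_density_bigcup (F : (set S)^nat) :
  (forall k, measurable (F k)) -> trivIset setT F ->
  (forall k, exists h, future_density (F k) h) ->
  exists h, future_density (\bigcup_k F k) h.
Proof.
move=> mF tF /choice[h hF].
exists (fun x => \sum_(0 <= k <oo) h k x); split.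
- apply: ge0_emeasurable_sum => k.
    by move=> x _ _; case: (hF k).
  by move=> _; case: (hF k).
- by move=> x; apply: nneseries_ge0 => k _ _; case: (hF k).
move=> n E bE; have mE := box_measurable bE.
rewrite integral_nneseries//; last 2 first.
- by move=> k; have [mh _ _] := hF k; exact: measurable_funTS (measurable_fun_coord n mh).
- by move=> k x _; case: (hF k).
rewrite preimage_bigcup setI_bigcupr measure_semi_bigcup.
- by apply: eq_eseriesr => k _; have [_ _ hk] := hF k; exact: hk.
- by move=> k; apply: measurableI => //; exact: measurable_iter_preimage.
- apply: trivIset_setIl; apply/trivIsetP => i j _ _ ij.
  by rewrite -preimage_setI; move/trivIsetP: tF => ->//; rewrite preimage_set0.
- by apply: bigcup_measurable => k _; apply: measurableI => //;
    exact: measurable_iter_preimage.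
Qed.

(** For an event fixing [w 0] in [A] and its shift in [D], the density at [x] is the indicator of
    [A] times the [K x]-mean of the density of [D]; this is the Markov property for one step. *)
Lemma future_density_box m C : box m C -> exists h, future_density C h.
Proof.
elim: m C => [|m IH] C.
  move=> /box0_inv[A mA ->]; exists (fun x => (\1_A x)%:E); split.
  - exact/measurable_EFinP/measurable_indic.
  - by move=> x; rewrite lee_fin.
  move=> n E bE; have mE := box_measurable bE.
  rewrite setIC -integral_indic//; last first.
    exact: measurable_iter_preimage (measurable_coord_set 0 mA).
  apply: eq_integral => w _; rewrite !indicE; congr (_%:R%:E).
  by congr (nat_of_bool _); apply/idP/idP; rewrite !inE /= iter_seqshiftE addn0.
move=> /boxS_inv[A [D [mA /IH[h [mh h0 hD]] ->]]].
have mKh := measurable_giry_comp mK mh h0.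
have Kh0 x : 0 <= giry_int (K x) h by exact: integral_ge0.
exists (fun x => giry_int (K x) h * (\1_A x)%:E); split.
- by apply: emeasurable_funM => //; exact/measurable_EFinP/measurable_indic.
- by move=> x; rewrite mule_ge0// lee_fin.
move=> n E bE.
have bEA : box n (E `&` [set w | A (w n)]) by apply: boxI => //; exact: box_coord.
rewrite [X in Q X](_ : _ =
    (E `&` [set w | A (w n)]) `&` iter n.+1 shift @^-1` D); last first.
  by rewrite -setIA; congr (_ `&` _); apply/seteqP; split=> w /=;
    rewrite iter_seqshiftE addn0.
rewrite hD; last exact: box_widen bEA.
rewrite markov_integral// integral_mkcondr.
apply: eq_integral => w _; rewrite /patch indicE.
by rewrite [w \in _](_ : _ = (w n \in A))// -?asboolE; case: ifPn; rewrite ?mule1 ?mule0.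
Qed.

(** The induction carries mere existence, because the sum of densities produced for a disjoint union
    is not bounded by 1 pointwise. The bound is restored at the end by truncation. *)
Lemma future_density_exists C : measurable C ->
  exists h, future_density C h /\ forall x, h x <= 1.
Proof.
move=> mC; suff [h hC] : exists h, future_density C h.
  exists (fun x => mine (h x) 1); split; first exact: future_density_truncate.
  by move=> x; rewrite ge_min lexx orbT.
move: C mC; apply: box_induction => [|n E|E mE [h hE]|F].
- exact: (future_density_box (boxT 0)).
- exact: future_density_box.
- by exists (fun x => 1 - mine (h x) 1); exact: future_densityC.
- exact: future_density_bigcup.
Qed.

Lemma integral_coord0 (g : T -> \bar R) :
  measurable_fun [set: T] g -> (forall x, 0 <= g x) ->
  \int[Q]_w g (w 0%N) = \int[mu]_x g x.
Proof.
move=> mg g0.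
have := @ge0_integral_pushforward _ _ S T R (fun w : S => w 0%N) (measurable_coord 0) Q setT g measurableT mg.
rewrite preimage_setT => <-//.
by apply: eq_measure_integral => [|? A mA _]; [exact: measurable_coord|exact: lawQ.1 _ mA].
Qed.

(** With [E] the whole space, the density of [C] turns both probabilities into integrals of [h],
    against the laws of [w 1] and [w 0]. Stationarity of [mu] makes these laws equal. *)
Lemma seqshift_preserving C : measurable C -> Q (shift @^-1` C) = Q C.
Proof.
move=> mC; have [h [[mh h0 hC] _]] := future_density_exists mC.
have := hC 1%N setT (boxT 1); have := hC 0%N setT (boxT 0).
rewrite !setTI /= => -> ->.
rewrite (markov_integral (boxT 0))//.
have mKh := measurable_giry_comp mK mh h0.
have Kh0 x : 0 <= giry_int (K x) h by exact: integral_ge0.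
rewrite (integral_coord0 mh h0) [LHS](integral_coord0 mKh Kh0).
transitivity (giry_int (giry_bind mu mK) h); first by rewrite giry_int_bind.
apply: eq_measure_integral => A mA _.
rewrite -[RHS]stationary// [LHS]giry_int_map//; exact: measurable_giry_ev.
Qed.

Lemma iter_preimage_invariant (A : set S) n :
  shift @^-1` A = A -> iter n shift @^-1` A = A.
Proof.
move=> invA; elim: n => [//|n IH].
by rewrite -[RHS]IH -[in RHS]invA.
Qed.

Section InvariantSet.
Context {A : set S} {h : T -> \bar R}.
Hypothesis mA : measurable A.
Hypothesis invA : shift @^-1` A = A.
Hypothesis hA : future_density A h.
Hypothesis h1 : forall x, h x <= 1.

Let mh : measurable_fun [set: T] h. Proof. by case: hA. Qed.
Let h0 x : 0 <= h x. Proof. by case: hA. Qed.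
Let mhn n : measurable_fun [set: S] (fun w : S => h (w n)).
Proof. exact: measurable_fun_coord. Qed.
Let hn0 n (w : S) : 0 <= h (w n). Proof. exact: h0. Qed.

Lemma future_density_invariant n E : box n E ->
  Q (E `&` A) = \int[Q]_(w in E) h (w n).
Proof. by case: hA => _ _ H /H; rewrite iter_preimage_invariant. Qed.

Lemma integral_future_density_le n C : measurable C ->
  \int[Q]_(w in C) h (w n) <= Q C.
Proof.
move=> mC; rewrite -[leRHS]mul1e -integral_cst//.
apply: ge0_le_integral => //; first exact: measurable_funTS.
Qed.

(* Levy's zero-one law, in weak form. *)
Lemma cvg_integral_future_density C : measurable C ->
  \int[Q]_(w in C) h (w n) @[n --> \oo] --> Q (C `&` A).
Proof.
move: C; apply: box_induction.
- rewrite [X in X @ _ --> _](_ : _ = cst (Q ([set: S] `&` A))); first exact: cvg_cst.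
  by apply/funext => n; rewrite -future_density_invariant//; exact: boxT.
(* Once [n] is at least [m], the integral equals the limit exactly. *)
- move=> m C bC; apply: cvg_near_cst; near=> n.
  apply: esym; apply: future_density_invariant; apply: box_widen bC.
  by near: n; exact: nbhs_infty_ge.
- move=> C mC cvgC.
  rewrite setIC -setDE measureD//; last by rewrite ltey_eq fin_num_measure.
  rewrite [X in X @ _ --> _](_ : _ = (fun n => Q A - \int[Q]_(w in C) h (w n))).
    apply: cvgeB; [|exact: cvg_cst|by rewrite setIC].
    by rewrite fin_num_adde_defr// fin_num_measure.
  apply/funext => n.
  (* The whole space is a box of any length, so the full integral of [h (w n)] is [Q A] for every
     [n]. *)
  rewrite -[A]setTI (future_density_invariant (boxT n)).
  rewrite (@ge0_integralID _ _ _ Q setT C)// setTI setTD addeAC subee ?add0e//.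
  by rewrite ge0_fin_numE ?integral_ge0// (le_lt_trans (integral_future_density_le n mC))//
    ltey_eq fin_num_measure.
move=> F mF tF cvgF.
have sumQ : \sum_(0 <= k <oo) Q (F k) = Q (\bigcup_k F k).
  by rewrite measure_semi_bigcup//; exact: bigcup_measurable.
rewrite setI_bigcupl measure_semi_bigcup//; last 3 first.
- by move=> k; exact: measurableI.
- exact: trivIset_setIr.
- by apply: bigcup_measurable => k _; exact: measurableI.
(* The series becomes an integral over the counting measure, where dominated convergence applies
   with the summable bound [Q (F k)]. *)
rewrite -ge0_integral_count//.
rewrite [X in X @ _ --> _](_ : _ =
    (fun n => \int[counting]_k \int[Q]_(w in F k) h (w n))); last first.
  apply/funext => n; rewrite ge0_integral_bigcup//; last first.
    exact: measurable_funTS.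
  rewrite ge0_integral_count// => k; exact: integral_ge0.
have [] := @dominated_convergence _ nat R counting setT measurableT
  (fun n k => \int[Q]_(w in F k) h (w n)) (fun k => Q (F k `&` A)) (fun k => Q (F k)).
- by [].
- by [].
- by apply: aeW => k _; exact: cvgF.
- apply/integrableP; split => //.
  under eq_integral do rewrite gee0_abs//.
  by rewrite ge0_integral_count// sumQ ltey_eq fin_num_measure//; exact: bigcup_measurable.
- apply: aeW => k n _; rewrite gee0_abs ?integral_ge0//.
  exact: integral_future_density_le.
by [].
Unshelve. all: by end_near. Qed.

(** Invariance of [A] and of [Q] under the shift makes the integral of [h (w n)] over [A]
    independent of [n], so it equals its limit. *)
Lemma integral_future_density_self : \int[Q]_(w in A) h (w 0%N) = Q A.
Proof.
have cst n : \int[Q]_(w in A) h (w n) = \int[Q]_(w in A) h (w 0%N).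
  elim: n => [//|n <-].
  rewrite -[in LHS]invA.
  have := @ge0_integral_pushforward _ _ S S R shift measurable_seqshift Q A
    (fun w : S => h (w n)) mA (measurable_funTS (mhn n)).
  move=> <-//; apply: eq_measure_integral => [|? C mC _].
    exact: measurable_seqshift.
  exact: seqshift_preserving.
have := cvg_integral_future_density mA; rewrite setIid.
under eq_cvg do rewrite cst.
by move=> /cvg_lim <-//; rewrite lim_cst.
Qed.

Lemma invariant_set_coord0 : exists B, [/\ measurable B,
  Q (A `\` [set w | B (w 0%N)]) = 0 & Q ([set w | B (w 0%N)] `\` A) = 0].
Proof.
(* As [h] is at most 1, this is the set where [h] equals 1. On [A] the integral of [1 - h (w 0)]
   vanishes, so [A] is almost surely inside; on the event that [w 0] lies in this set, [h]
   integrates to the full probability, so that event is almost surely inside [A]. *)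
exists [set x | 1 <= h x].
have mB : measurable [set x | 1 <= h x].
  rewrite -[X in measurable X]setTI; apply: measurable_lee.
  - by [].
  - exact: measurable_cst.
  - exact: mh.
split=> //.
  have m1B : measurable_fun [set: S] (fun w : S => 1 - h (w 0%N)).
    by apply: emeasurable_funB => //; exact: measurable_cst.
  have hfin x : h x \is a fin_num.
    by rewrite ge0_fin_numE// (le_lt_trans (h1 x))// ltry.
  have ge (w : S) : 0 <= 1 - h (w 0%N) by rewrite sube_ge0 ?h1// hfin orbT.
  have gt1B0 : \int[Q]_(w in A) (1 - h (w 0%N)) = 0.
    have fA : Q A \is a fin_num by rewrite fin_num_measure.
    rewrite -[LHS](addeK _ fA) -{1}integral_future_density_self.
    rewrite -ge0_integralD//; [|exact: measurable_funTS..].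
    under eq_integral do rewrite subeK//.
    by rewrite integral_cst// mul1e subee.
  rewrite -(ge0_integral_eq0_null mA m1B ge gt1B0); congr (Q _).
  apply/seteqP; split=> w [Aw /= hw]; split=> //=.
    by rewrite sube_gt0 ltNge; exact/negP.
  by apply/negP; rewrite -ltNge -sube_gt0.
have mB0 := measurable_coord_set 0 mB.
rewrite measureD//; last by rewrite ltey_eq fin_num_measure.
have /= -> := future_density_invariant (box_coord (leqnn 0) mB).
rewrite (eq_integral (cst 1)) ?integral_cst ?mul1e ?subee ?fin_num_measure//.
by move=> w /[!inE] /= hw; apply/eqP; rewrite eq_le h1.
Qed.

End InvariantSet.

Lemma integral_coord0_set (B : set T) (g : T -> \bar R) : measurable B ->
  measurable_fun [set: T] g -> (forall x, 0 <= g x) ->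
  \int[Q]_(w in [set w | B (w 0%N)]) g (w 0%N) = \int[mu]_(x in B) g x.
Proof.
move=> mB mg g0.
rewrite [RHS]integral_mkcond -(integral_coord0).
- rewrite integral_mkcond; apply: eq_integral => w _.
  by rewrite /patch; congr (if _ then _ else _); apply/idP/idP; rewrite !inE.
- by apply/(measurable_restrictT _ mB)/measurable_funTS.
- by move=> x; rewrite /patch; case: ifP.
Qed.

(** The hypothesis is irreducibility: a set that the chain almost surely neither leaves nor enters
    is trivial. *)
Lemma markov_chain_ergodic :
  (forall B, measurable B -> \int[mu]_(x in B) K x (~` B) = 0 ->
     \int[mu]_(x in ~` B) K x B = 0 -> mu B = 0 \/ mu B = 1) ->
  ergodic Q [set shift].
Proof.
move=> irr; split=> [_ ->|A mA inv].
  by split; [exact: measurable_seqshift|exact: seqshift_preserving].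
have {}inv : shift @^-1` A = A by exact: inv.
have [h [hA h1]] := future_density_exists mA.
have [B [mB AB BA]] := invariant_set_coord0 mA inv hA h1.
have mBn n := @measurable_coord_set _ _ n _ mB.
(* Shifting the identification of [A] by one step shows that [A] is also almost surely the event
   that [w 1] is in [B]. Hence [w 0] and [w 1] are almost surely both in [B] or both outside. *)
have AB1 : Q (A `\` [set w | B (w 1%N)]) = 0.
  by rewrite -[A]inv -AB -[RHS]seqshift_preserving//; exact: measurableD.
have BA1 : Q ([set w | B (w 1%N)] `\` A) = 0.
  by rewrite -[A]inv -BA -[RHS]seqshift_preserving//; exact: measurableD.
have QA : Q A = mu B.
  rewrite -(lawQ.1 _ mB) (measureDI Q mA (mBn 0%N)) [X in X + _]AB add0e.
  by rewrite [RHS](measureDI Q (mBn 0%N) mA) [X in _ = X + _]BA add0e setIC.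
rewrite QA; apply: irr => //.
  rewrite -integral_coord0_set//; last first.
    by apply: measurable_giry_eval => //; exact: measurableC.
  rewrite -(markov_set (box_coord (leqnn 0) mB)); last exact: measurableC.
  apply: (@subset_measure0 _ _ _ Q _
      (([set w | B (w 0%N)] `\` A) `|` (A `\` [set w | B (w 1%N)]))).
  - by apply: measurableI => //; apply: measurable_coord_set; exact: measurableC.
  - by apply: measurableU; exact: measurableD.
  - by move=> w /= [B0 B1]; have [Aw|nAw] := pselect (A w); [right|left].
  - by apply: null_set_setU => //; exact: measurableD.
rewrite -integral_coord0_set//; [|exact: measurableC|exact: measurable_giry_eval].
rewrite -(markov_set (box_coord (leqnn 0) (measurableC mB)))//.
apply: (@subset_measure0 _ _ _ Q _
    ((A `\` [set w | B (w 0%N)]) `|` ([set w | B (w 1%N)] `\` A))).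
- by apply: measurableI => //; apply: measurable_coord_set; exact: measurableC.
- by apply: measurableU; exact: measurableD.
- by move=> w /= [B0 B1]; have [Aw|nAw] := pselect (A w); [left|right].
- by apply: null_set_setU => //; exact: measurableD.
Qed.

End StationaryMarkovChain.

(** * Enumerating the lattice by natural numbers *)

Section LatticeEnumeration.
Variable d : nat.

(** Numbers that code no point are sent to 0. This is harmless in unions and intersections, but sums
    must be restricted to [lattice_code], lest 0 be counted repeatedly. *)
Definition lattice_point (n : nat) : Zd d :=
  odflt (0%R : 'rV[int]_d) (pickle_inv n).

Definition lattice_code : pred nat :=
  [pred n | isSome (pickle_inv n : option 'rV[int]_d)].

Lemma lattice_pointK (y : Zd d) : exists2 n, lattice_code n & lattice_point n = y.
Proof.
by exists (pickle (y : 'rV[int]_d)); rewrite /lattice_code /lattice_point /= pickleK_inv.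
Qed.

Lemma esum_lattice {R : realType} (a : Zd d -> \bar R) : (forall y, 0 <= a y) ->
  \esum_(y in [set: Zd d]) a y =
  \sum_(0 <= n <oo | n \in lattice_code) a (lattice_point n).
Proof.
move=> a0; rewrite -(@esum_pred_image _ _ a lattice_point lattice_code)//.
  congr esum; apply/seteqP; split=> // y _ /=.
  by have [n cn <-] := lattice_pointK y; exists n.
move=> m n; rewrite !inE /lattice_code /lattice_point /=.
case Em: (pickle_inv m) => [x|//]; case En: (pickle_inv n) => [y|//] _ _ /= xy.
by have := pickle_invK (T:='rV[int]_d) m; have := pickle_invK (T:='rV[int]_d) n;
  rewrite Em En /= xy => -> ->.
Qed.

End LatticeEnumeration.
Arguments lattice_point {d}.

(** * The environment viewed from the particle *)

Section Environment.
Context {R : realType} {disp : measure_display} {Omega : measurableType disp}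
  {d : nat} {Pi : probability Omega R}
  {p : Omega -> Zd d -> Zd d -> R} {tau : Zd d -> Omega -> Omega}
  {Gamma : zmodClosed (Zd d)}.
Hypothesis env : random_environment Pi p tau.
Local Notation evp := (evp_kernel p tau).

Let p_ge0 w x y : (0 <= p w x y)%R. Proof. exact: env_ge0 env _ _ _. Qed.

Lemma measurable_tau z : measurable_fun [set: Omega] (tau z).
Proof. by have [] := env_tau_preserving env z. Qed.

Lemma measurable_tau_preimage z (B : set Omega) :
  measurable B -> measurable (tau z @^-1` B).
Proof. by move=> mB; rewrite -[X in measurable X]setTI; exact: measurable_tau. Qed.

Lemma p_shift w x y : p w x y = p (tau x w) 0%R (y - x)%R.
Proof. by rewrite (env_shift env) add0r subrK. Qed.

Lemma evp_kernel_gt0 w y (C : set Omega) :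
  (0 < p w 0 y)%R -> C (tau y w) -> 0 < evp w C.
Proof.
move=> py Cy; apply/esum_gt0P => [z|]; first by rewrite mule_ge0// lee_fin.
by exists y; rewrite indicE mem_set// mule1 lte_fin.
Qed.

Lemma evp_giry : exists K : Omega -> giry Omega R,
  measurable_fun setT K /\ forall w B, K w B = evp w B.
Proof.
(* The kernel is a countable mixture of Dirac masses; the factor [lattice_code] removes the spurious
   copies of the origin. *)
pose c w n := NngNum (mulr_ge0 (p_ge0 w 0%R (lattice_point n)) (ler0n R (lattice_code d n))).
pose m w : {measure set Omega -> \bar R} :=
  mseries (fun n => mscale (c w n) (\d_(tau (lattice_point n) w))) 0.
have mE w B : m w B = evp w B.
  rewrite /evp esum_lattice; last by move=> y; rewrite mule_ge0// lee_fin.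
  rewrite [RHS]eseries_mkcond; apply: eq_eseriesr => n _.
  rewrite -[LHS]/((p w 0%R (lattice_point n) * (lattice_code d n)%:R)%:E *
    (\1_B (tau (lattice_point n) w))%:E).
  rewrite -[n \in _]/(lattice_code d n).
  by case: (lattice_code d n); rewrite ?mulr1 ?mulr0 ?mul0e.
have m1 w : m w setT <= 1.
  rewrite mE -(env_sum1 env w 0%R); apply: le_esum => y _.
  by rewrite indicT mule1.
pose K w : giry Omega R := HB.pack_for (SubProbability.type Omega R) (Measure.sort (m w))
  (Measure_isSubProbability.Build _ _ _ (m w) (m1 w)).
exists K; split; last exact: mE.
apply: measurable_giry_codensity => // B mB.
rewrite (_ : (fun w => _) = fun w => \sum_(0 <= n <oo | n \in lattice_code d)
  (p w 0%R (lattice_point n))%:E * (\1_B (tau (lattice_point n) w))%:E).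
  apply: ge0_emeasurable_sum => n; first by move=> x _ _; rewrite mule_ge0// lee_fin.
  move=> _; apply: emeasurable_funM; first exact/measurable_EFinP/(env_measurable env).
  apply/measurable_EFinP/(measurableT_comp (measurable_indic mB)).
  exact: measurable_tau.
apply/funext => w; rewrite [LHS]mE /evp esum_lattice// => y.
by rewrite mule_ge0// lee_fin.
Qed.

Lemma path_weight_ge0 w x s : (0 <= path_weight (p w) x s)%R.
Proof. by elim: s x => [|y s IH] x /=; rewrite ?ler01// mulr_ge0. Qed.

Lemma path_weight_closed (B : set Omega) w x s y :
  (forall x y, B (tau x w) -> (0 < p w x y)%R -> B (tau y w)) ->
  (0 < path_weight (p w) x (rcons s y))%R -> B (tau x w) -> B (tau y w).
Proof.
move=> closedB; elim: s x => [|z s IH] x /=.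
  by rewrite mulr1 => pxy Bx; exact: closedB Bx pxy.
move=> pw Bx.
have pxz : (0 < p w x z)%R.
  rewrite lt_neqAle p_ge0 andbT eq_sym; apply: contraTneq pw => ->.
  by rewrite mul0r ltxx.
by apply: (IH z); [rewrite pmulr_rgt0 in pw|exact: closedB Bx pxz].
Qed.

Lemma nstep_gt0P w n x y : 0 < nstep (p w) n x y <->
  exists s : n.-1.-tuple (Zd d), (0 < path_weight (p w) x (rcons s y))%R.
Proof.
rewrite esum_gt0P; last by move=> s; rewrite lee_fin path_weight_ge0.
by split=> -[s]; rewrite ?lte_fin => sy; exists s; rewrite ?lte_fin.
Qed.

Lemma measurable_path_weight x s :
  measurable_fun [set: Omega] (fun w => path_weight (p w) x s).
Proof.
elim: s x => [|y s IH] x /=; first exact: measurable_cst.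
by apply: measurable_funM => //; exact: (env_measurable env).
Qed.

(** Positivity of an n-step probability means that some path has positive weight, and there are
    countably many paths and targets. *)
Lemma measurable_Omega_t : measurable (Omega_t p Gamma).
Proof.
pose U y n (k : nat) : set Omega :=
  if unpickle k : option (n.-1.-tuple 'rV[int]_d) is Some s
  then [set w | (0 < path_weight (p w) 0%R (rcons (s : seq (Zd d)) y))%R] else set0.
rewrite (_ : Omega_t p Gamma = \bigcap_(k in [set k | lattice_point k \in Gamma])
   \bigcup_(n in [set n | (1 <= n)%N]) \bigcup_k' U (lattice_point k) n k').
  apply: bigcap_measurableType => k _; apply: bigcup_measurable => n _.
  apply: bigcup_measurable => k' _; rewrite /U; case: unpickle => // s.
  rewrite -[X in measurable X]setTI; apply: measurable_fun_ltr => //.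
  exact: measurable_path_weight.
apply/seteqP; split=> [w wt k /= Gk|w wt y Gy].
  have [n n1 /nstep_gt0P[s sw]] := wt _ Gk.
  exists n => //; exists (pickle (s : n.-1.-tuple 'rV[int]_d)) => //.
  by rewrite /U pickleK.
have [k _ ky] := lattice_pointK y; rewrite -ky in Gy *.
have [n n1 [k' _]] := wt _ Gy.
rewrite /U; case: unpickle => // s sw; exists n => //.
by apply/nstep_gt0P; exists s.
Qed.

Context {Pis : probability Omega R}.
Hypothesis ergodic_env : ergodic_environment Pi tau Gamma.
Hypothesis steady : ac_steady_state Pi p tau Gamma Pis.

Lemma evp_closed_full (B : set Omega) : measurable B ->
  \int[Pis]_(w in B) evp w (~` B) = 0 ->
  0 < Pis (B `&` Omega_t p Gamma) -> Pis B = 1.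
Proof.
move=> mB exitB Bt; have [ac stat _] := steady.
have [S [mS PisS nullS]] := ac_support ac.
have [K [mK KE]] := evp_giry.
have mevp C : measurable C -> measurable_fun [set: Omega] (evp ^~ C).
  move=> mC; rewrite (_ : evp ^~ C = fun w => K w C).
    exact: measurable_giry_eval.
  by apply/funext => w; rewrite KE.
have evp0 w C : 0 <= evp w C by rewrite -KE.
have null C D : measurable C -> measurable D -> \int[Pis]_(w in C) evp w D = 0 ->
    Pis (C `&` [set w | 0 < evp w D]) = 0.
  by move=> mC mD; apply: ge0_integral_eq0_null => //; exact: mevp.
pose B' := B `&` S.
have mB' : measurable B' by exact: measurableI.
(* Environments in [B'] from which the step [z] is possible and leads out of [B']. *)
pose exit z : set Omega := [set w | (0 < p w 0 z)%R] `&` (B' `\` tau z @^-1` B').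
have mexit z : measurable (exit z).
  apply: measurableI.
    rewrite -[X in measurable X]setTI; apply: measurable_fun_ltr => //.
    exact: (env_measurable env).
  by apply: measurableD => //; exact: measurable_tau_preimage.
have Pis_exit z : Pis (exit z) = 0.
  have mgt C D : measurable C -> measurable D -> measurable (C `&` [set w | 0 < evp w D]).
    by move=> mC mD; apply: measurable_lte => //; apply: measurable_funTS; exact: mevp.
  apply: (@subset_measure0 _ _ _ Pis _ ((B `&` [set w | 0 < evp w (~` B)]) `|`
      ([set: Omega] `&` [set w | 0 < evp w (~` S)]))) => //.
  - by apply: measurableU; apply: mgt => //; exact: measurableC.
  - move=> w [pz [[Bw Sw]]] /= nB'.
    have [Bz|nBz] := pselect (B (tau z w)).
      by right; split => //; apply: evp_kernel_gt0 pz _ => Sz; exact: nB'.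
    by left; split => //; exact: evp_kernel_gt0 pz _.
  - apply: null_set_setU; first by apply: mgt => //; exact: measurableC.
    + by apply: mgt => //; exact: measurableC.
    + by apply: null => //; exact: measurableC.
    + by apply: null => //; [exact: measurableC|rewrite stat//; exact: measurableC].
(* The exit set lies inside [S], where [Pis]-null sets are [Pi]-null. *)
have Pi_exit z : Pi (exit z) = 0.
  by apply: nullS => // w [_ [[]]].
(* All lattice translates are taken, since a path ending in [Gamma] may pass through points outside
   [Gamma]. *)
pose N := \bigcup_i \bigcup_j
  tau (lattice_point i) @^-1` exit (lattice_point j).
have mN : measurable N.
  apply: bigcup_measurable => i _; apply: bigcup_measurable => j _.
  exact: measurable_tau_preimage.
have PiN : Pi N = 0.
  apply: measure_negligible => //; apply: negligible_bigcup => i.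
  apply: negligible_bigcup => j; apply/negligibleP; first exact: measurable_tau_preimage.
  have [_ pres] := env_tau_preserving env (lattice_point i).
  exact: etrans (pres _ (mexit _)) (Pi_exit _).
pose G := [set w | forall y, y \in Gamma -> B' (tau y w)].
have mG : measurable G.
  rewrite (_ : G = \bigcap_(i in [set i | lattice_point i \in Gamma])
      tau (lattice_point i) @^-1` B').
    by apply: bigcap_measurableType => i _; exact: measurable_tau_preimage.
  apply/seteqP; split=> [w Gw i /= Gi|w Gw y Gy]; first exact: Gw.
  by have [i _ iy] := lattice_pointK y; rewrite -iy in Gy *; exact: Gw.
have invG f : (tau @` [set z | z \in Gamma]) f -> f @^-1` G = G.
  move=> [z Gz <-]; apply/seteqP; split=> w Gw y Gy.
    rewrite -[y](subrK z) (env_tauD env); apply: Gw.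
    exact: rpredB.
  by rewrite -(env_tauD env); apply: Gw; exact: rpredD.
have dom C : measurable C -> Pi C = 0 -> Pis C = 0.
  exact: (null_content_dominatesP _ _).1.
(* Off [N], no step of positive probability leads out of [B'] anywhere in the lattice, so a path
   from the origin to [y] keeps the environment in [B']. *)
have subG : B `&` Omega_t p Gamma `<=` G `|` (N `|` ~` S).
  move=> w [Bw wt]; have [Sw|] := pselect (S w); last by right; right.
  have [Nw|nNw] := pselect (N w); first by right; left.
  left=> y Gy; have [n _ /nstep_gt0P[s sw]] := wt _ Gy.
  apply: (path_weight_closed _ sw); last by rewrite (env_tau0 env).
  move=> x z B'x; rewrite p_shift => pxz; apply: contrapT => nB'z; apply: nNw.
  have [i _ ix] := lattice_pointK x; have [j _ jz] := lattice_pointK (z - x)%R.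
  exists i => //; exists j => //; rewrite ix jz; split => //; split => //=.
  by rewrite -(env_tauD env) subrK.
have GB : G `<=` B.
  by move=> w /(_ 0%R (rpred0 _)); rewrite (env_tau0 env) => -[].
(* If [G] were [Pi]-null, the inclusion [subG] would make the positive measure in [Bt] vanish. *)
have [PiG|PiG] := ergodic_env.2 _ mG invG.
  move: Bt; rewrite (_ : Pis _ = 0) ?ltxx//.
  apply: (@subset_measure0 _ _ _ Pis _ (G `|` (N `|` ~` S))) => //.
  - by apply: measurableI => //; exact: measurable_Omega_t.
  - apply: measurableU => //; apply: measurableU => //; exact: measurableC.
  - apply: null_set_setU => //; [|exact: dom|].
      by apply: measurableU => //; exact: measurableC.
    by apply: null_set_setU => //; [exact: measurableC|exact: dom].
have PisG : Pis (~` G) = 0.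
  apply: dom; first exact: measurableC.
  by rewrite probability_setC// PiG subee.
have PisB : Pis (~` B) = 0.
  apply: (subset_measure0 (measurableC mB) (measurableC mG) _ PisG).
  exact: subsetC.
by rewrite -[B]setCK probability_setC ?PisB ?sube0//; exact: measurableC.
Qed.

(** Entering [B] is leaving its complement, so [evp_closed_full] is available for both; positivity
    of [Pis] on [Omega_t] guarantees that it applies to at least one. *)
Lemma evp_ergodic (Q : probability (seqspace Omega) R) :
  markov_chain_law Pis evp Q -> ergodic Q [set @seqshift disp Omega].
Proof.
move=> lawQ; have [_ stat Pist] := steady; have [K [mK KE]] := evp_giry.
have evpE : evp = fun w B => K w B by apply/funext => w; apply/funext => B; rewrite KE.
rewrite evpE in lawQ.
apply: (markov_chain_ergodic mK lawQ) => [B mB|B mB].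
  by under eq_integral do rewrite KE; exact: stat.
under eq_integral do rewrite KE; move=> exitB.
under eq_integral do rewrite KE; move=> exitC.
have mCB := measurableC mB.
have mt := measurable_Omega_t.
have [Bt|Bt] := eqVneq (Pis (B `&` Omega_t p Gamma)) 0; last first.
  by right; apply: evp_closed_full => //; rewrite lt_neqAle eq_sym Bt measure_ge0.
left; rewrite -[B]setCK probability_setC// evp_closed_full ?subee// ?setCK//.
move: Pist; rewrite (measureDI Pis mt mB) setIC [X in _ + X]Bt adde0.
by rewrite setDE setIC.
Qed.

End Environment.

Local Close Scope ereal_scope.

Theorem corollary1p4 (R : realType) (d : nat)
    (disp : measure_display) (Omega : measurableType disp)
    (Pi : probability Omega R)
    (p : Omega -> Zd d -> Zd d -> R) (tau : Zd d -> Omega -> Omega)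
    (Gamma : zmodClosed (Zd d))
    (* the quenched laws and the annealed law of the walk *)
    (P : Omega -> probability (seqspace (Zd d)) R)
    (PP : probability (seqspace (Zd d) * Omega)%type R)
    (Pis : probability Omega R)
    (Q : probability (seqspace Omega) R) :
  random_environment Pi p tau ->
  (forall w, walk_law (p w) (P w)) ->
  annealed_law Pi P PP ->
  no_deterministic_walks p tau PP ->
  decaying_transitions Pi p ->
  ergodic_environment Pi tau Gamma ->
  partial_transitivity Pi p Gamma ->
  ac_steady_state Pi p tau Gamma Pis ->
  markov_chain_law Pis (evp_kernel p tau) Q ->
  ergodic Q [set @seqshift disp Omega].
Proof.
move=> env _ _ _ _ ergodic_env _ steady lawQ.
exact (evp_ergodic env ergodic_env steady lawQ).
Qed.
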